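(* For any $\gamma>0$, $\gamma\ne 1$, and any integer $K\ge 2$, the maximal quadratic risk of the plug-in estimator $\hat F_\gamma$ is asymptotically bounded from below by $$\sup_{p\in\mathcal{P}_K}\mathbb{E}\left[(\hat F_\gamma-F_\gamma)^2\right]\gtrsim_\gamma\frac{K^2}{(\alpha^2 n)^\gamma}\qquad\text{as } n\to\infty.$$
   Context: $[K]=\{1,\dots,K\}$, $n$ is a positive integer, and the privacy level $\alpha\in(0,1)$ satisfies $\alpha^2 n\ge 1$. $\mathcal{P}_K=\{p\in[0,1]^K:\sum_{k=1}^K p_k=1\}$, and $F_\gamma=F_\gamma(p)=\sum_{k=1}^K p_k^\gamma$. The sensitive data $x_1,\dots,x_n$ are i.i.d. with $\mathbb{P}(x_i=k)=p_k$, $k\in[K]$. The Laplace non-interactive privacy mechanism releases $z_i=(z_{i1},\dots,z_{iK})$ with $z_{ik}=\mathbf{1}_{\{x_i=k\}}+\frac{\sigma}{\alpha}w_{ik}$, where $\sigma=2$ and the $w_{ik}$ are i.i.d. with density $\frac12 e^{-|x|}$ on $\mathbb{R}$, independent of the $x_i$. Let $\hat z_k=\frac1n\sum_{i=1}^n z_{ik}$ and $T_{[0,2]}[y]=\min\{\max\{y,0\},2\}$. The plug-in estimator is $\hat F_\gamma=\sum_{k=1}^K(T_{[0,2]}[\hat z_k])^\gamma$. ''$x\gtrsim_\gamma y$ as $n\to\infty$'' means: there is a constant $c_\gamma>0$ depending only on $\gamma$ such that, for given $K$ and $\alpha$, the inequality $x\ge c_\gamma y$ holds for all sufficiently large $n$.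 *)

(* Defs.v *)
From HB Require Import structures.
From mathcomp Require Import all_boot all_order all_algebra.
From mathcomp Require Import all_classical all_reals all_analysis.

Set Implicit Arguments.
Unset Strict Implicit.
Unset Printing Implicit Defensive.

Import Order.TTheory GRing.Theory Num.Theory.
Import numFieldNormedType.Exports.
Local Open Scope classical_set_scope.
Local Open Scope ring_scope.

Definition prob_simplex (R : realType) (K : nat) : set ('I_K -> R) :=
  [set p | (forall k, 0 <= p k <= 1) /\ \sum_(k < K) p k = 1].
Arguments prob_simplex : clear implicits.

Definition power_sum (R : realType) (K : nat) (gamma : R) (p : 'I_K -> R) : R :=
  \sum_(k < K) p k `^ gamma.

Definition laplace_pdf (R : realType) (y : R) : R := 2^-1 * expR (- `|y|).

(* Mutual independence of a finite family of classes of events. *)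
Definition mutually_independent (d : measure_display) (T : measurableType d)
    (R : realType) (P : probability T R) (I : finType)
    (F : I -> set (set T)) : Prop :=
  forall (J : {set I}) (A : I -> set T),
    (forall j, j \in J -> F j (A j)) ->
    P (\big[setI/setT]_(j in J) A j) = (\prod_(j in J) P (A j))%E.

(* A realization, on an arbitrary probability space, of the sensitive data x_i
   and of the unscaled Laplace noise w_ik. The alphabet 'I_K carries the
   discrete sigma-algebra. Independence is that of the generated sigma-algebras,
   jointly over all the x_i (index inl i) and all the w_ik (index inr (i, k)),
   so it also gives the independence of the noise from the data. *)
Record experiment (R : realType) (K n : nat) (p : 'I_K -> R) := Experiment {
  disp : measure_display ;
  space : measurableType disp ;
  law : probability space R ;
  data : 'I_n -> space -> 'I_K ;
  noise : 'I_n -> 'I_K -> {RV law >-> R} ;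
  data_measurable : forall i (A : set 'I_K), measurable (data i @^-1` A) ;
  data_law : forall i k, law (data i @^-1` [set k]) = (p k)%:E ;
  noise_law : forall i k (B : set R), measurable B ->
    distribution law (noise i k) B =
      (\int[lebesgue_measure]_(y in B) (laplace_pdf y)%:E)%E ;
  data_noise_independent : mutually_independent law
    (fun j : 'I_n + 'I_n * 'I_K =>
       match j with
       | inl i => preimage_set_system setT (data i) setT
       | inr ik => preimage_set_system setT (noise ik.1 ik.2) measurable
       end) }.

Definition sigma (R : realType) : R := 2.

Definition privatized (R : realType) (K n : nat) (p : 'I_K -> R)
    (E : experiment n p) (alpha : R) (i : 'I_n) (k : 'I_K) (t : space E) : R :=
  (data i t == k)%:R + sigma R / alpha * noise E i k t.

Definition privatized_mean (R : realType) (K n : nat) (p : 'I_K -> R)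
    (E : experiment n p) (alpha : R) (k : 'I_K) (t : space E) : R :=
  n%:R^-1 * \sum_(i < n) privatized alpha i k t.

Definition clip02 (R : realType) (y : R) : R := Num.min (Num.max y 0) 2.

Definition plugin_estimator (R : realType) (K n : nat) (p : 'I_K -> R)
    (E : experiment n p) (gamma alpha : R) (t : space E) : R :=
  \sum_(k < K) clip02 (privatized_mean alpha k t) `^ gamma.

Definition quadratic_risk (R : realType) (K n : nat) (p : 'I_K -> R)
    (E : experiment n p) (gamma alpha : R) : \bar R :=
  'E_(law E)[fun t => (plugin_estimator gamma alpha t - power_sum gamma p) ^+ 2].

(* The risk depends on E only through its joint law, which p, K and n fix, so
   the choice of one realization E p for each p does not matter. *)
Definition maximal_risk (R : realType) (K n : nat)
    (E : forall p : prob_simplex R K, experiment n (\val p))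
    (gamma alpha : R) : \bar R :=
  ereal_sup [set quadratic_risk (E p) gamma alpha | p in [set: prob_simplex R K]].

(* Main.v *)
(* Take p = (1, 0, ..., 0).  The estimates of the K - 1 null coordinates are
   clipped pure noise, and positive parts do not average out: each contributes
   about (alpha^2 n)^(-gamma/2) to the estimator with constant probability.
   To keep the first coordinate from compensating this, restrict to the event
   that the noise of its estimate is nonnegative, where that coordinate
   contributes at least 1 = F_gamma.  The two events concern disjoint columns of
   the noise, hence are independent, and the lower bound on the second moment
   follows from E Y^2 >= 2 l E Y - l^2.  The tail bound for a sum of Laplace
   variables is a second moment argument applied to its exponential, whose
   moments are explicit. *)
Require Import Defs.
From HB Require Import structures.
From mathcomp Require Import all_boot all_order all_algebra.
From mathcomp Require Import all_classical all_reals all_analysis.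
From mathcomp Require Import measurable_realfun ring lra.
Import Order.TTheory GRing.Theory Num.Theory.
Import numFieldNormedType.Exports.
Local Open Scope ring_scope.
Local Open Scope classical_set_scope.

Set Implicit Arguments.
Unset Strict Implicit.
Unset Printing Implicit Defensive.

(** * Densities and the Laplace moment generating function *)

(** Having a density makes [nu] absolutely continuous with respect to [mu]. The Radon-Nikodym
    derivative and [g] have equal integrals over every measurable set, hence agree almost
    everywhere. *)
Lemma ge0_integral_density (d : measure_display) (T : measurableType d)
    (R : realType) (nu : {finite_measure set T -> \bar R})
    (mu : {sigma_finite_measure set T -> \bar R}) (g : T -> R) :
  measurable_fun setT g -> (forall x, 0 <= g x) ->
  (forall A, measurable A -> nu A = (\int[mu]_(x in A) (g x)%:E)%E) ->
  forall f : T -> \bar R, measurable_fun setT f -> (forall x, (0 <= f x)%E) ->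
  (\int[nu]_x f x = \int[mu]_x (f x * (g x)%:E))%E.
Proof.
move=> mg g0 nuE f mf f0.
have mgE : measurable_fun setT (EFin \o g) by exact/measurable_EFinP.
have dom : nu `<< mu.
  apply/null_content_dominatesP => A mA muA0.
  by rewrite nuE// null_set_integral//; exact: measurable_funTS.
rewrite -(Radon_Nikodym_SigmaFinite.change_of_variables dom)//.
have mh := measurable_int _ (Radon_Nikodym_SigmaFinite.f_integrable dom).
apply: ge0_ae_eq_integral => //=.
- exact: emeasurable_funM.
- exact: emeasurable_funM.
- by move=> x _; rewrite mule_ge0//; exact: Radon_Nikodym_SigmaFinite.f_ge0.
- by move=> x _; rewrite mule_ge0// lee_fin.
apply: ae_eqe_mul2l; apply: integral_ae_eq => //.
  exact: Radon_Nikodym_SigmaFinite.f_integrable.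
by move=> A _ mA; rewrite -Radon_Nikodym_SigmaFinite.f_integral// nuE.
Qed.

(** Read off from the total mass 1 of the exponential density; an infinite integral would make that
    mass infinite. *)
Lemma integral_expRN (R : realType) (r : R) : 0 < r ->
  (\int[lebesgue_measure]_(x in `[0%R, +oo[) (expR (- r * x))%:E
    = (r^-1)%:E)%E.
Proof.
move=> r0; have := integral_exponential_pdf r0.
have -> : (\int[lebesgue_measure]_x (exponential_pdf r x)%:E =
    \int[lebesgue_measure]_(x in `[0%R, +oo[) (r%:E * (expR (- r * x))%:E))%E.
  rewrite [RHS]integral_mkcond; apply: eq_integral => x _.
  by rewrite /exponential_pdf !patchE; case: ifP.
rewrite ge0_integralZl//=; last 2 first.
- by apply: measurable_funTS; do 3!apply: measurableT_comp => //.
- by rewrite lee_fin ltW.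
have : (0 <= \int[lebesgue_measure]_(x in `[0%R, +oo[) (expR (- r * x))%:E)%E.
  by apply: integral_ge0 => x _; rewrite lee_fin expR_ge0.
case: (\int[_]_(x in _) _)%E => [s|_|//].
  rewrite lee_fin => s0 [] rs; congr EFin.
  by apply: (mulfI (lt0r_neq0 r0)); rewrite rs divff ?lt0r_neq0.
by rewrite gt0_muley ?lte_fin.
Qed.

Lemma measurable_laplace_pdf (R : realType) :
  measurable_fun setT (@laplace_pdf R).
Proof.
apply: measurable_funM => //; do 2!apply: measurableT_comp => //.
Qed.

(** Splitting at 0 gives two exponential integrals, with rates $1-u$ and $1+u$, both positive since
    $|u|<1$; their half-sum is $1/(1-u^2)$. *)
Lemma laplace_mmt_gen_fun (d : measure_display) (T : measurableType d)
    (R : realType) (P : probability T R) (X : {RV P >-> R}) (u : R) :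
  (forall B, measurable B -> distribution P X B =
    (\int[lebesgue_measure]_(y in B) (laplace_pdf y)%:E)%E) ->
  `|u| < 1 -> mmt_gen_fun P X u = ((1 - u ^+ 2)^-1)%:E.
Proof.
move=> HX; rewrite ltr_norml => /andP[u1 u2].
rewrite /mmt_gen_fun unlock.
(* [lebesgue_measure] and the noise law live on two measurable structures on R
   that share their measurable sets but not their display. *)
have mX : measurable_fun setT (X : T -> measurableTypeR R).
  by move=> mT B mB; exact: (@measurable_funP _ _ _ _ _ X mT B mB).
pose mixX := isMeasurableFun.Build _ _ _ _ (X : T -> measurableTypeR R) mX.
pose Y : {mfun T >-> measurableTypeR R} := HB.pack (X : T -> measurableTypeR R) mixX.
have mexp : measurable_fun setT (fun y : measurableTypeR R => (expR (y * u))%:E).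
  by apply/measurable_EFinP; apply: measurableT_comp => //; exact: measurable_funM.
have -> : (\int[P]_w ((expR \o u \o* X) w)%:E =
    \int[distribution P Y]_y (expR (y * u))%:E)%E.
  by rewrite ge0_integral_distribution// => y; rewrite lee_fin expR_ge0.
have pdf0 (x : R) : 0 <= laplace_pdf x by rewrite mulr_ge0 ?expR_ge0.
rewrite (ge0_integral_density (nu := distribution P Y) (mu := lebesgue_measure)
    (@measurable_laplace_pdf R) pdf0 HX mexp); last first.
  by move=> y; rewrite lee_fin expR_ge0.
set h := (fun x : R => ((expR (x * u))%:E * (laplace_pdf x)%:E)%E).
have mh : measurable_fun setT h.
  by apply: emeasurable_funM => //; apply/measurable_EFinP; exact: measurable_laplace_pdf.
have h0 x : (0 <= h x)%E by rewrite mule_ge0 ?lee_fin ?expR_ge0.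
rewrite [LHS](_ : _ = \int[lebesgue_measure]_x h x)%E//.
rewrite -(setUv `[0%R, +oo[) ge0_integral_setU//=; last 3 first.
- exact: measurableC.
- by rewrite setUv.
- exact/disj_setPCl.
rewrite setCitvr integral_itv_bndo_bndc; last exact: measurable_funTS.
rewrite [X in (_ + X)%E](_ : _ =
  (\int[lebesgue_measure]_(x in `[0%R, +oo[) h (- x)%R)%E); last first.
  rewrite ge0_integration_by_substitution0//; last exact: measurableT_comp.
  by under [RHS]eq_integral do rewrite opprK.
rewrite (eq_integral
   (fun x : measurableTypeR R => ((2^-1)%:E * (expR (- (1 - u) * x))%:E)%E)); last first.
  move=> x; rewrite inE/= in_itv/= andbT => x0.
  rewrite /h /laplace_pdf ger0_norm// mulrC EFinM muleCA -EFinM -expRD -!EFinM.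
  by congr (_ * expR _)%:E; ring.
rewrite [X in (_ + X)%E](eq_integral
   (fun x : measurableTypeR R => ((2^-1)%:E * (expR (- (1 + u) * x))%:E)%E)); last first.
  move=> x; rewrite inE/= in_itv/= andbT => x0.
  rewrite /h /laplace_pdf normrN ger0_norm// EFinM muleCA -EFinM -expRD -!EFinM.
  by congr (_ * expR _)%:E; ring.
rewrite !ge0_integralZl//=.
- rewrite !integral_expRN; [|lra|lra].
  rewrite -!EFinM -EFinD; congr EFin.
  by field; rewrite !lt0r_neq0//; nra.
- by apply: measurable_funTS; do 3!apply: measurableT_comp => //.
- by apply: measurable_funTS; do 3!apply: measurableT_comp => //.
Qed.

(** * Sums of independent random variables *)

(** Uniqueness of the product measure, applied to the image of [P] restricted to [G]: agreement on
    rectangles suffices. *)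
Lemma probability_pair_setI (d d1 d2 : measure_display) (T : measurableType d)
    (T1 : measurableType d1) (T2 : measurableType d2) (R : realType)
    (P : probability T R) (Y : {mfun T >-> T1}) (Z : {mfun T >-> T2})
    (G : set T) :
  measurable G ->
  (forall A B, measurable A -> measurable B ->
    P (Y @^-1` A `&` (Z @^-1` B `&` G)) =
    (P (Y @^-1` A) * (P (Z @^-1` B) * P G))%E) ->
  forall C, measurable C -> P ((fun t => (Y t, Z t)) @^-1` C `&` G) =
    ((distribution P Y \x distribution P Z) C * P G)%E.
Proof.
move=> mG YZG C mC.
have mYZ : measurable_fun setT (fun t => (Y t, Z t)) by exact: measurable_fun_pair.
pose mixYZ := isMeasurableFun.Build _ _ _ _ (fun t => (Y t, Z t)) mYZ.
pose W : {mfun T >-> (T1 * T2)%type} := HB.pack (fun t => (Y t, Z t)) mixYZ.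
(* The factor [P G] is absorbed as a scaling of the first marginal, which avoids conditioning on a
   possibly null [G]. *)
pose r : {nonneg R} := NngNum (fine_ge0 (measure_ge0 P G)).
have rE : (r%:num%:E = P G)%E by rewrite /= fineK// fin_num_measure.
have -> : P ((fun t => (Y t, Z t)) @^-1` C `&` G) =
    pushforward (mrestr P mG) W C by [].
rewrite -(@product_measure_unique _ _ _ _ _ (mscale r (distribution P Y))
   (distribution P Z))//.
  rewrite /product_measure1 ge0_integral_mscale//= ?rE 1?muleC//.
  exact: measurable_fun_xsection.
move=> A B mA mB; rewrite [LHS](_ : _ = P (Y @^-1` A `&` (Z @^-1` B `&` G))); last first.
  by rewrite setIA.
by rewrite YZG//= /mscale rE muleA muleC muleA.
Qed.

Section independent_sums.
Context (d : measure_display) (T : measurableType d) (R : realType)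
  (P : probability T R) (I : eqType) (X : I -> {RV P >-> R}).
Implicit Types (s J : seq I) (G : set T).

Definition rv_sum s (t : T) : R := \sum_(j <- s) X j t.

Lemma measurable_rv_sum s : measurable_fun setT (rv_sum s).
Proof. exact: measurable_sum. Qed.

HB.instance Definition _ s :=
  isMeasurableFun.Build _ _ _ _ (rv_sum s) (@measurable_rv_sum s).

Definition cylinder J (B : I -> set R) : set T :=
  \big[setI/setT]_(j <- J) (X j @^-1` B j).

Lemma measurable_cylinder J B : (forall j, measurable (B j)) ->
  measurable (cylinder J B).
Proof. by move=> mB; apply: bigsetI_measurable => j _; exact: measurable_funPTI. Qed.

(** For [G = setT] this is mutual independence of the [X j], [j] in [s]. Carrying a general [G] is
    what lets inductions on [s] go through. *)
Definition indep_event s G := forall J B, uniq J -> {subset J <= s} ->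
  (forall j, measurable (B j)) ->
  P (cylinder J B `&` G) = (\prod_(j <- J) P (X j @^-1` B j) * P G)%E.

Lemma indep_eventS s s' G : {subset s' <= s} ->
  indep_event s G -> indep_event s' G.
Proof. by move=> ss' sG J B uJ Js'; apply: sG => // j /Js' /ss'. Qed.

Lemma indep_event1 i s G A : indep_event (i :: s) G -> measurable A ->
  P (X i @^-1` A `&` G) = (P (X i @^-1` A) * P G)%E.
Proof.
move=> isG mA; have := isG [:: i] (fun=> A).
rewrite /cylinder !big_seq1; apply => // j; rewrite !inE => ->//.
Qed.

(** A constraint on [X i] can be moved into [G]: apply the hypothesis to the cylinder extended by
    [A] at [i]. *)
Lemma indep_event_cons i s G A : i \notin s -> measurable A ->
  indep_event (i :: s) G -> indep_event s (X i @^-1` A `&` G).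
Proof.
move=> iNs mA isG J B uJ Js mB.
have iNJ : i \notin J by apply: contra iNs => /Js.
have JB j : j \in J -> (if j == i then A else B j) = B j.
  by move=> jJ; case: eqP => // ji; rewrite -ji jJ in iNJ.
have : P (cylinder (i :: J) (fun j => if j == i then A else B j) `&` G) =
    (\prod_(j <- i :: J) P (X j @^-1` (if j == i then A else B j)) * P G)%E.
  apply: isG => [|j|j]; first by rewrite /= iNJ.
    by rewrite !inE => /predU1P[->|/Js ->]; rewrite ?eqxx ?orbT.
  by case: ifP.
rewrite /cylinder !big_cons eqxx.
rewrite (eq_big_seq (fun j => X j @^-1` B j)); last by move=> j /JB ->.
rewrite (eq_big_seq (fun j => P (X j @^-1` B j))); last by move=> j /JB ->.
rewrite (indep_event1 isG)// setIA [_ `&` X i @^-1` A]setIC => ->.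
by rewrite [X in (X * _)%E]muleC muleA.
Qed.

(** On a rectangle, the event on [X i] joins [G] and the assumed factorization for the sum over [s]
    applies. That factorization is a premise so that the lemma can serve inside the induction
    proving it. *)
Lemma rv_sum_pair_setI i s G : i \notin s -> measurable G ->
  indep_event (i :: s) G ->
  (forall G', measurable G' -> indep_event s G' -> forall A, measurable A ->
     P (rv_sum s @^-1` A `&` G') = (P (rv_sum s @^-1` A) * P G')%E) ->
  forall C, measurable C -> P ((fun t => (X i t, rv_sum s t)) @^-1` C `&` G) =
    ((distribution P (X i) \x distribution P (rv_sum s)) C * P G)%E.
Proof.
move=> iNs mG isG IH C mC; apply: probability_pair_setI => // A B mA mB.
rewrite setICA IH//.
- by rewrite (indep_event1 isG)// muleCA.
- by apply: measurableI => //; exact: measurable_funPTI.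
- exact: indep_event_cons.
Qed.

(** Induction on [s] for all [G] at once: the sum is a function of the pair formed by its head and
    its tail sum. *)
Lemma rv_sum_indep_event s G A : uniq s -> indep_event s setT ->
  measurable G -> indep_event s G -> measurable A ->
  P (rv_sum s @^-1` A `&` G) = (P (rv_sum s @^-1` A) * P G)%E.
Proof.
move=> + + + + mA; elim: s G A mA => [|i s IH] G A mA.
  move=> _ _ _ _; have -> : rv_sum [::] = cst 0.
    by apply/funext => t; rewrite /rv_sum big_nil.
  rewrite preimage_cst; case: ifP => _; first by rewrite setTI probability_setT mul1e.
  by rewrite set0I measure0 mul0e.
move=> /andP[iNs us] isT mG isG.
have sT : indep_event s setT.
  by apply: indep_eventS isT => j js; rewrite inE js orbT.
have -> : rv_sum (i :: s) @^-1` A =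
    (fun t => (X i t, rv_sum s t)) @^-1` ((fun xy : R * R => xy.1 + xy.2) @^-1` A).
  by apply/seteqP; split => t /=; rewrite /rv_sum big_cons.
have mC : measurable ((fun xy : R * R => xy.1 + xy.2) @^-1` A).
  by rewrite -[X in measurable X]setTI; apply: measurable_funD.
have IHs G' (mG' : measurable G') (sG' : indep_event s G') A' (mA' : measurable A')
  := IH G' A' mA' us sT mG' sG'.
rewrite (rv_sum_pair_setI iNs mG isG IHs mC); congr (_ * _)%E.
(* The case [G = setT] identifies the product measure of the preimage with the probability of the
   event on the sum. *)
have := rv_sum_pair_setI iNs measurableT isT IHs mC.
by rewrite setIT probability_setT mule1.
Qed.

(** The previous result is used twice: for [s1] with [G] the event on the sum over [s2], and, to
    justify this [G], for [s2] with a cylinder over [s1]. *)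
Lemma rv_sum_indep s1 s2 A B : uniq (s1 ++ s2) -> indep_event (s1 ++ s2) setT ->
  measurable A -> measurable B ->
  P (rv_sum s1 @^-1` A `&` rv_sum s2 @^-1` B) =
  (P (rv_sum s1 @^-1` A) * P (rv_sum s2 @^-1` B))%E.
Proof.
rewrite cat_uniq => /and3P[u1 /hasPn s12 u2] s12T mA mB.
have s1T : indep_event s1 setT.
  by apply: indep_eventS s12T => j j1; rewrite mem_cat j1.
have s2T : indep_event s2 setT.
  by apply: indep_eventS s12T => j j2; rewrite mem_cat j2 orbT.
apply: rv_sum_indep_event => //; first exact: measurable_funPTI.
move=> J1 B1 uJ1 J1s1 mB1.
have := s1T J1 B1 uJ1 J1s1 mB1; rewrite setIT probability_setT mule1 => PJ1.
rewrite setIC rv_sum_indep_event//; first by rewrite PJ1 muleC.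
  exact: measurable_cylinder.
move=> J2 B2 uJ2 J2s2 mB2.
have J12 j : j \in J1 -> j \notin J2.
  by move=> /J1s1 j1; apply/negP => /J2s2 /s12; rewrite j1.
pose B12 j := if j \in J1 then B1 j else B2 j.
have E1 j : j \in J1 -> B12 j = B1 j by rewrite /B12 => ->.
have E2 j : j \in J2 -> B12 j = B2 j.
  by rewrite /B12; case: ifP => // /J12 /negbTE ->.
have : P (cylinder (J2 ++ J1) B12 `&` setT) =
    (\prod_(j <- J2 ++ J1) P (X j @^-1` B12 j) * P setT)%E.
  apply: s12T => [|j|j].
  - by rewrite cat_uniq uJ1 uJ2 andbT/=; apply/hasPn => j; exact: J12.
  - by rewrite !mem_cat => /orP[/J2s2 ->|/J1s1 ->]//; rewrite orbT.
  - by rewrite /B12; case: ifP.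
rewrite /cylinder !big_cat/= setIT probability_setT mule1.
rewrite (eq_big_seq (fun j => X j @^-1` B2 j)); last by move=> j /E2 ->.
rewrite [X in P (_ `&` X)](eq_big_seq (fun j => X j @^-1` B1 j)); last by move=> j /E1 ->.
rewrite (eq_big_seq (fun j => P (X j @^-1` B2 j))); last by move=> j /E2 ->.
rewrite [X in (_ = _ * X -> _)%E](eq_big_seq (fun j => P (X j @^-1` B1 j))); last first.
  by move=> j /E1 ->.
by rewrite -PJ1.
Qed.

(** The head and the tail sum have a product law, and Tonelli separates the exponential of their
    sum. *)
Lemma mmt_gen_fun_rv_sum s u : uniq s -> indep_event s setT ->
  mmt_gen_fun P (rv_sum s) u = (\prod_(j <- s) mmt_gen_fun P (X j) u)%E.
Proof.
have mexp : measurable_fun setT (fun y : R => (expR (y * u))%:E).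
  by apply/measurable_EFinP; apply: measurableT_comp => //; exact: measurable_funM.
have mgfE (Y : {RV P >-> R}) : mmt_gen_fun P Y u =
    (\int[distribution P Y]_y (expR (y * u))%:E)%E.
  rewrite ge0_integral_distribution//.
  by rewrite /mmt_gen_fun unlock.
elim: s => [|i s IH].
  move=> _ _; rewrite big_nil /mmt_gen_fun (_ : _ \o _ = cst 1) ?expectation_cst//.
  by apply/funext => t /=; rewrite /rv_sum big_nil mul0r expR0.
move=> /= /andP[iNs us] isT; rewrite big_cons -IH//; last first.
  by apply: indep_eventS isT => j js; rewrite inE js orbT.
have sT : indep_event s setT.
  by apply: indep_eventS isT => j js; rewrite inE js orbT.
have pairE := rv_sum_pair_setI iNs measurableT isT
  (fun G' mG' sG' A mA => rv_sum_indep_event us sT mG' sG' mA).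
have mW : measurable_fun setT (fun t => (X i t, rv_sum s t)).
  by apply: measurable_fun_pair.
have mf : measurable_fun setT (fun xy : R * R => (expR ((xy.1 + xy.2) * u))%:E).
  apply: (measurableT_comp mexp); exact: measurable_funD.
transitivity (\int[pushforward P (fun t => (X i t, rv_sum s t))]_xy
    (expR ((xy.1 + xy.2) * u))%:E)%E.
  rewrite ge0_integral_pushforward//.
  rewrite /mmt_gen_fun unlock; apply: eq_integral => t _ /=.
  by rewrite /rv_sum big_cons.
transitivity (\int[distribution P (X i) \x distribution P (rv_sum s)]_xy
    (expR ((xy.1 + xy.2) * u))%:E)%E.
  apply: eq_measure_integral => C mC _.
  by have := pairE _ mC; rewrite setIT probability_setT mule1.
rewrite fubini_tonelli1//=.
rewrite /fubini_F/=.
under eq_integral => x _.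
  under eq_integral do rewrite mulrDl expRD EFinM.
  rewrite ge0_integralZl//.
  rewrite -mgfE.
  over.
rewrite ge0_integralZr//.
- by rewrite -mgfE.
- by apply: expectation_ge0 => t; exact: expR_ge0.
Qed.

End independent_sums.

(** * Anti-concentration of a sum of Laplace variables *)

Lemma bernoulli_ineq (R : realFieldType) (x : R) n :
  -1 <= x -> 1 + n%:R * x <= (1 + x) ^+ n.
Proof.
move=> x1; elim: n => [|n IH]; first by rewrite mul0r addr0 expr0.
rewrite exprS (le_trans _ (ler_wpM2l _ IH))//; last by lra.
have := mulr_ge0 (ler0n R n) (sqr_ge0 x).
by rewrite -natr1; lra.
Qed.

(** Integrates a pointwise lower bound on an indicator. Its negative terms are moved across, so that
    only nonnegative functions are integrated. *)
Lemma mmt_gen_fun_le_probability (d : measure_display) (T : measurableType d)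
    (R : realType) (P : probability T R) (S : {RV P >-> R}) (A : set T)
    (u v a b c : R) :
  measurable A -> 0 <= a -> 0 <= b -> 0 <= c ->
  (forall t, a * expR (S t * u) <= \1_A t + (b * expR (S t * v) + c)) ->
  (a%:E * mmt_gen_fun P S u <= P A + (b%:E * mmt_gen_fun P S v + c%:E))%E.
Proof.
move=> mA a0 b0 c0 H.
have mX (w : R) : measurable_fun setT (fun t => (expR (S t * w))%:E).
  by apply/measurable_EFinP; apply: measurableT_comp => //; exact: measurable_funM.
have EXE (w : R) : mmt_gen_fun P S w = (\int[P]_t (expR (S t * w))%:E)%E.
  by rewrite /mmt_gen_fun unlock.
have X0 (w : R) t : (0 <= (expR (S t * w))%:E)%E by rewrite lee_fin expR_ge0.
rewrite -[P A]mul1e -(setIT A) -integral_indic// mul1e.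
rewrite -[X in (_ + (_ + X))%E]mule1 -(@probability_setT _ _ _ P).
rewrite -integral_cst// !EXE -!ge0_integralZl//=.
have mbX : measurable_fun setT (fun t => (b%:E * (expR (S t * v))%:E)%E).
  exact: emeasurable_funM.
rewrite -ge0_integralD//; last by move=> t _; rewrite mule_ge0.
rewrite -ge0_integralD//; last 3 first.
- exact/measurable_EFinP/measurable_indic.
- by move=> t _; rewrite adde_ge0// mule_ge0.
- exact: emeasurable_funD.
apply: ge0_le_integral => //.
- by move=> t _; rewrite mule_ge0.
- exact: emeasurable_funM.
- apply: emeasurable_funD; first exact/measurable_EFinP/measurable_indic.
  exact: emeasurable_funD.
- by move=> t _; rewrite -!EFinM -!EFinD lee_fin.
Qed.

(* With u = 1/(4 sqrt n), X = exp(u S) has E X >= 17/16 and E X^2 <= 4/3, and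
   integrating 1_{X >= a} >= 2 delta (X - a) - delta^2 X^2 with a = 33/32 and
   delta = 1/64 gives P (X >= a) >= 1/1536. *)
Lemma laplace_sum_tail (d : measure_display) (T : measurableType d)
    (R : realType) (P : probability T R) (S : {RV P >-> R}) (n : nat) :
  (0 < n)%N ->
  (forall u : R, `|u| < 1 -> mmt_gen_fun P S u = ((1 - u ^+ 2) ^- n)%:E) ->
  ((1536^-1)%:E <=
    P [set t | (4 * ln (33/32) * Num.sqrt n%:R <= S t)%R])%E.
Proof.
move=> n_gt0 mmt_S.
have n0 : 0 < n%:R :> R by rewrite ltr0n.
have n1 : 1 <= n%:R :> R by rewrite ler1n.
have s1 : 1 <= Num.sqrt n%:R :> R by rewrite -[X in X <= _]sqrtr1 ler_wsqrtr.
have sn : Num.sqrt n%:R ^+ 2 = n%:R :> R by rewrite sqr_sqrtr ?ltW.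
have s0 : 0 < Num.sqrt n%:R :> R by lra.
set A := [set t | _]; set s := Num.sqrt n%:R in sn s0 s1 A *.
pose u : R := (4 * s)^-1.
have u0 : 0 < u by rewrite invr_gt0; lra.
have u2 : n%:R * u ^+ 2 = 16^-1.
  by rewrite /u -sn; field; rewrite lt0r_neq0.
have u4 : u <= 4^-1 by rewrite /u lef_pV2 ?posrE; lra.
have mA : measurable A.
  rewrite (_ : A = S @^-1` `[4 * ln (33/32) * s, +oo[); first exact: measurable_funPTI.
  by apply/seteqP; split => t /=; rewrite in_itv/= andbT.
have mX (v : R) : measurable_fun setT (fun t => expR (S t * v)).
  by apply: measurableT_comp => //; exact: measurable_funM.
have AE t : A t = (33 / 32 <= expR (S t * u)).
  rewrite -[X in X <= expR _](@lnK _ (33/32 : R)) ?posrE; last lra.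
  rewrite ler_expR /u ler_pdivlMr; last by lra.
  by rewrite /A/= mulrA [_ * 4]mulrC.
have EX : ((17/16)%:E <= mmt_gen_fun P S u)%E.
  rewrite mmt_S ?gtr0_norm//; last lra.
  rewrite lee_fin -[X in _ <= X]mul1r ler_pdivlMr; last by rewrite exprn_gt0; nra.
  have -> : 17/16 = 1 + n%:R * u ^+ 2 by rewrite u2; lra.
  (* Uses $(1+u^2)^n(1-u^2)^n=(1-u^4)^n\le 1$. *)
  rewrite (le_trans (ler_wpM2r _ (@bernoulli_ineq _ (u ^+ 2) n _)))//.
  - by rewrite exprn_ge0; nra.
  - by nra.
  - by rewrite -exprMn exprn_ile1//; nra.
have EX2 : (mmt_gen_fun P S (u * 2)%R <= (4/3)%:E)%E.
  rewrite mmt_S ?gtr0_norm//; [|nra|lra].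
  (* Here $(1-4u^2)^n\ge 1-4nu^2=3/4$. *)
  have := @bernoulli_ineq _ (- (u * 2) ^+ 2) n.
  have -> : n%:R * - (u * 2) ^+ 2 = - 4^-1.
    by rewrite exprMn mulrN mulrA u2; lra.
  move=> /(_ ltac:(nra)) H.
  rewrite lee_fin -[_ ^- n]mul1r ler_pdivrMr; lra.
(* The coefficients are $2\delta$, $\delta^2$ and $2\delta a$. *)
have := @mmt_gen_fun_le_probability _ _ _ P S A u (u * 2)
  32^-1 4096^-1 (33/1024) mA.
rewrite -[P A]fineK ?fin_num_measure//; move: EX EX2.
rewrite !mmt_S ?gtr0_norm//; [|nra|lra|lra].
rewrite -!EFinM -!EFinD !lee_fin => EX EX2.
suff H t : 32^-1 * expR (S t * u) <=
    \1_A t + (4096^-1 * expR (S t * (u * 2)) + 33 / 1024).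
  have r1 : 0 <= 32^-1 :> R by lra.
  have r2 : 0 <= 4096^-1 :> R by lra.
  have r3 : 0 <= 33 / 1024 :> R by lra.
  move=> /(_ r1 r2 r3 H); lra.
rewrite mulrA expRM_natr indicE.
have := expR_gt0 (S t * u); move: (expR _) (AE t) => X AtE X0.
(* On [A] the bound follows from $(\delta X-1)^2\ge 0$; off [A], from $X<a$. *)
case: (boolP (t \in A)) => [_|/negP] /=.
  suff : 0 <= (X / 64 - 1) ^+ 2 by rewrite sqrrB expr1n mulr1; lra.
  exact: sqr_ge0.
rewrite inE AtE => /negP; rewrite -ltNge => Xa.
by have := sqr_ge0 X; lra.
Qed.

(** * Second moment lower bound *)

(** Integrate $2l|Y|\le Y^2+l^2$, where $l$ is the lower bound that the events [G i] give for
    $\mathbb{E}|Y|$; then $2l^2-l^2=l^2$ remains. *)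
Lemma expectation_sqr_ge (d : measure_display) (T : measurableType d)
    (R : realType) (P : probability T R) (I : Type) (s : seq I)
    (G : I -> set T) (Y : T -> R) (w q : R) :
  measurable_fun setT Y -> 0 <= w -> 0 <= q ->
  (forall i, measurable (G i)) -> (forall i, q%:E <= P (G i))%E ->
  (forall t, w * (\sum_(i <- s) \1_(G i) t) <= `|Y t|) ->
  (((w * (q *+ size s)) ^+ 2)%:E <= expectation P (fun t => Y t ^+ 2)%R)%E.
Proof.
move=> mY w0 q0 mG qG wY; set l := w * _.
have l0 : 0 <= l by rewrite mulr_ge0// mulrn_wge0.
have mY2 : measurable_fun setT (fun t => (Y t ^+ 2)%:E).
  by apply/measurable_EFinP; exact: measurable_funX.
have mS : measurable_fun setT (fun t => \sum_(i <- s) (\1_(G i) t)%:E : \bar R)%E.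
  by apply: emeasurable_sum => i; exact/measurable_EFinP/measurable_indic.
have S0 t : (0 <= \sum_(i <- s) (\1_(G i) t)%:E :> \bar R)%E.
  by apply: sume_ge0 => i _; rewrite lee_fin.
have lw0 : 0 <= 2 * l * w by rewrite mulr_ge0// mulr_ge0.
have : (\int[P]_t ((2 * l * w)%:E * \sum_(i <- s) (\1_(G i) t)%:E) <=
    \int[P]_t ((Y t ^+ 2)%:E + (l ^+ 2)%:E))%E.
  apply: ge0_le_integral => //.
  - by move=> t _; rewrite mule_ge0.
  - exact: emeasurable_funM.
  - exact: emeasurable_funD.
  - move=> t _; rewrite sumEFin -EFinM -EFinD lee_fin.
    have := sqr_ge0 (`|Y t| - l); rewrite sqrrB real_normK ?num_real// => H.
    have := ler_wpM2l (mulr_ge0 (ler0n R 2) l0) (wY t); rewrite mulrA.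
    by rewrite -mulr_natl in H; lra.
have Y20 t : (0 <= (Y t ^+ 2)%:E)%E by rewrite lee_fin sqr_ge0.
have l20 : (0 <= (l ^+ 2)%:E)%E by rewrite lee_fin sqr_ge0.
rewrite ge0_integralD// integral_cst//.
rewrite [X in (_ <= _ + _ * X)%E -> _](@probability_setT _ _ _ P) mule1.
rewrite ge0_integralZl//.
rewrite ge0_integral_sum//; last by move=> i; exact/measurable_EFinP/measurable_indic.
under eq_bigr do rewrite integral_indic// setIT.
have PG : ((q *+ size s)%:E <= \sum_(i <- s) P (G i))%E.
  elim: (s) => [|i s' IH]; first by rewrite big_nil mulr0n.
  by rewrite big_cons /= mulrS EFinD leeD.
have -> : expectation P (fun t => Y t ^+ 2)%R = (\int[P]_t (Y t ^+ 2)%:E)%E by rewrite unlock.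
move=> H.
have := le_trans (lee_wpmul2l (_ : 0 <= (2 * l * w)%:E)%E PG) H.
rewrite lee_fin => /(_ lw0).
rewrite -EFinM -leeBlDr// -EFinB; apply: le_trans.
by rewrite lee_fin -(mulrA (2 * l)) -/l; lra.
Qed.

(** * Noise columns and the data under a degenerate law *)

Section noise_columns.
Context (R : realType) (K n : nat) (p : 'I_K -> R) (E : experiment n p).
Local Notation P := (law E).

Definition noise_pair (ik : 'I_n * 'I_K) : {RV P >-> R} := noise E ik.1 ik.2.

Definition column (k : 'I_K) : seq ('I_n * 'I_K) := [seq (i, k) | i <- enum 'I_n].

Lemma indep_event_noise s : indep_event noise_pair s setT.
Proof.
move=> J B uJ _ mB; rewrite setIT probability_setT mule1 /cylinder.
have inrI : injective (@inr 'I_n ('I_n * 'I_K)) by move=> ? ? [].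
(* Only noise indices enter the intersection; [setT] at data indices is a placeholder. *)
pose A (x : 'I_n + 'I_n * 'I_K) :=
  if x is inr ik then noise_pair ik @^-1` B ik else setT.
have := @data_noise_independent _ _ _ _ E (inr @: [set j in J])%SET A.
rewrite !big_imset; [|by move=> ? ? _ _ /inrI..].
have -> : \big[setI/setT]_(j <- J) (noise_pair j @^-1` B j) =
    \big[setI/setT]_(j in [set j in J]%SET) (noise_pair j @^-1` B j).
  by rewrite big_uniq//; apply: eq_bigl => j; rewrite inE.
have -> : (\prod_(j <- J) P (noise_pair j @^-1` B j) =
    \prod_(j in [set j in J]%SET) P (noise_pair j @^-1` B j))%E.
  by rewrite big_uniq//; apply: eq_bigl => j; rewrite inE.
apply => x /imsetP[ik _ ->].
by exists (B ik) => //; rewrite setTI.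
Qed.

Lemma uniq_column k : uniq (column k).
Proof. by rewrite map_inj_uniq ?enum_uniq// => i j []. Qed.

Lemma uniq_columns k l : k != l -> uniq (column k ++ column l).
Proof.
move=> kl; rewrite cat_uniq !uniq_column andbT/=.
apply/hasPn => _ /mapP[i _ ->]; apply/mapP => -[j _ [_ lk]].
by rewrite lk eqxx in kl.
Qed.

Lemma rv_sum_columnE k t :
  rv_sum noise_pair (column k) t = \sum_(i < n) noise E i k t.
Proof. by rewrite /rv_sum big_map big_enum. Qed.

Lemma mmt_gen_fun_column k u : `|u| < 1 ->
  mmt_gen_fun P (rv_sum noise_pair (column k)) u = ((1 - u ^+ 2) ^- n)%:E.
Proof.
move=> u1; rewrite mmt_gen_fun_rv_sum ?uniq_column//; last exact: indep_event_noise.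
under eq_bigr do rewrite (laplace_mmt_gen_fun (noise_law E _ _))//.
by rewrite big_map big_enum/= prodEFin prodr_const card_ord exprVn.
Qed.

Definition column_tail (c : R) k : set (Defs.space E) :=
  [set t | c * Num.sqrt n%:R <= \sum_(i < n) noise E i k t].

Lemma column_tailE c k : column_tail c k =
  rv_sum noise_pair (column k) @^-1` `[c * Num.sqrt n%:R, +oo[.
Proof.
by apply/seteqP; split=> t /=; rewrite in_itv/= andbT rv_sum_columnE.
Qed.

Lemma measurable_column_tail c k : measurable (column_tail c k).
Proof. by rewrite column_tailE; exact: measurable_funPTI. Qed.

(** Distinct columns share no noise variable, so the two tail events are independent and their lower
    bounds multiply. *)
Lemma column_tails_ge k l : (0 < n)%N -> k != l ->
  ((1536^-1 * 1536^-1)%:E <= P (column_tail (4 * ln (33/32)) k `&`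
                                column_tail (4 * ln (33/32)) l))%E.
Proof.
move=> n0 kl.
have tail j : ((1536^-1)%:E <= P (column_tail (4 * ln (33/32)) j))%E.
  apply: (le_trans (laplace_sum_tail n0 (@mmt_gen_fun_column j))).
  rewrite (_ : [set t | _] = column_tail (4 * ln (33/32)) j)//.
  by apply/seteqP; split=> t /=; rewrite rv_sum_columnE.
have : 0 <= 1536^-1 :> R by rewrite invr_ge0 ler0n.
move: (1536^-1) tail => q; move: (4 * ln _) => c tail q0.
have := tail k; have := tail l; rewrite !column_tailE => ql qk.
rewrite rv_sum_indep//.
- by rewrite EFinM; apply: lee_pmul; rewrite ?lee_fin.
- exact: uniq_columns.
- exact: indep_event_noise.
Qed.

Lemma measurable_data_eq i k : measurable_fun setT (fun t => (data (e := E) i t == k)%:R : R).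
Proof.
rewrite (_ : (fun _ => _) = \1_(data (e := E) i @^-1` [set k])).
  exact/measurable_indic/data_measurable.
apply/funext => t; rewrite indicE; congr ((_ : bool)%:R).
by apply/eqP/idP; rewrite inE.
Qed.

Lemma measurable_plugin_estimator gamma alpha :
  measurable_fun setT (plugin_estimator (E := E) gamma alpha).
Proof.
apply: measurable_sum => k; apply: (measurableT_comp (measurable_powR gamma)).
apply: measurable_minr => //; apply: measurable_maxr => //.
apply: measurable_funM => //; apply: measurable_sum => i.
apply: measurable_funD; first exact: measurable_data_eq.
by apply: measurable_funM.
Qed.

(** When [p k = 1] this event has probability one. Intersecting with it makes the data constant
    pointwise without changing probabilities. *)
Definition data_event (k : 'I_K) : set (Defs.space E) :=
  \big[setI/setT]_(i < n) (data (e := E) i @^-1` [set k]).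

Lemma measurable_data_event k : measurable (data_event k).
Proof. by apply: bigsetI_measurable => i _; exact: data_measurable. Qed.

Lemma data_eventP k t : data_event k t -> forall i, data (e := E) i t = k.
Proof.
by rewrite /data_event -bigcap_seq => + i => /(_ i); apply; rewrite /= mem_index_enum.
Qed.

Lemma probability_data_event k : p k = 1 -> P (data_event k) = 1%E.
Proof.
move=> pk.
have inlI : injective (@inl 'I_n ('I_n * 'I_K)) by move=> ? ? [].
pose A (x : 'I_n + 'I_n * 'I_K) :=
  if x is inl i then data (e := E) i @^-1` [set k] else setT.
have := @data_noise_independent _ _ _ _ E (inl @: [set: 'I_n])%SET A.
rewrite !big_imset; [|by move=> ? ? _ _ /inlI..].
rewrite [X in (_ -> X = _) -> _](_ : _ = P (data_event k)); last first.
  by congr (P _); apply: eq_bigl => j; rewrite inE.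
rewrite [X in (_ -> _ = X) -> _]big1; last by move=> i _; rewrite data_law pk.
apply => x /imsetP[i _ ->].
by exists [set k] => //; rewrite setTI.
Qed.

Lemma probability_setI_data_event k A : p k = 1 -> measurable A ->
  P (A `&` data_event k) = P A.
Proof.
move=> pk mA; rewrite [RHS](measureDI _ mA (measurable_data_event k)).
rewrite [X in _ = (X + _)%E](_ : _ = 0%E) ?add0e//; apply/eqP; rewrite eq_le measure_ge0 andbT.
have <- : P (~` data_event k) = 0%E.
  rewrite probability_setC ?probability_data_event ?subee//.
  exact: measurable_data_event.
apply: le_measure; rewrite ?inE.
- by apply: measurableD => //; exact: measurable_data_event.
- by apply: measurableC; exact: measurable_data_event.
- by move=> t [].
Qed.

End noise_columns.
Arguments data_event {R K n p} E k.
Arguments column_tail {R K n p} E c k.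

(** * Risk at a vertex of the simplex *)

Lemma clip02_ge (R : realType) (b y : R) : b <= 2 -> b <= y -> b <= clip02 y.
Proof. by move=> b2 bY; rewrite /clip02 le_min b2 le_max bY. Qed.

Section degenerate_law.
Context (R : realType) (m n : nat).

Definition vertex (k : 'I_m.+1) : R := (k == ord0)%:R.

Lemma vertex_simplex : prob_simplex R m.+1 vertex.
Proof.
split=> [k|]; first by rewrite /vertex ler0n lern1 leq_b1.
by rewrite big_ord_recl big1 ?addr0// => i _.
Qed.

Lemma power_sum_vertex gamma : 0 < gamma -> power_sum gamma vertex = 1.
Proof.
move=> g0; rewrite /power_sum big_ord_recl/= /vertex/= powR1 big1 ?addr0// => i _.
by rewrite powR0// gt_eqF.
Qed.

Context (E : experiment n vertex) (gamma alpha : R).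

Lemma privatized_meanE k t : 0 < alpha -> (0 < n)%N -> data_event E ord0 t ->
  privatized_mean alpha k t =
  (k == ord0)%:R + 2 / (alpha * n%:R) * \sum_(i < n) noise E i k t.
Proof.
move=> alpha_gt0 n_gt0 /data_eventP Dt; rewrite /privatized_mean /privatized.
under eq_bigr do rewrite Dt eq_sym.
rewrite big_split/= sumr_const card_ord -mulr_sumr /sigma -[_ *+ n]mulr_natl.
have n0 : n%:R != 0 :> R by rewrite pnatr_eq0 -lt0n.
by field; rewrite n0 gt_eqF.
Qed.

(** A column sum of at least $c\sqrt n$ becomes, after scaling by $2/(\alpha n)$, noise of at least
    $b=2c/(\alpha\sqrt n)$. The assumption $c\le\alpha\sqrt n$ gives $b\le 2$, so clipping preserves
    this bound. *)
Lemma quadratic_risk_vertex_ge (c q : R) :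
  0 < gamma -> 0 < alpha -> (0 < n)%N ->
  0 <= c -> c <= alpha * Num.sqrt n%:R -> 0 <= q ->
  (forall k, k != ord0 ->
    (q%:E <= law E (column_tail E c ord0 `&` column_tail E c k))%E) ->
  ((((2 * c / (alpha * Num.sqrt n%:R)) `^ gamma * (q *+ m)) ^+ 2)%:E <=
    quadratic_risk E gamma alpha)%E.
Proof.
move=> gamma_gt0 alpha_gt0 n_gt0 c0 cn q0 qP.
have n0 : 0 < n%:R :> R by rewrite ltr0n.
have s0 : 0 < Num.sqrt n%:R :> R by rewrite sqrtr_gt0.
set b := 2 * c / _.
have b0 : 0 <= b by rewrite divr_ge0 ?mulr_ge0// ltW.
have b2 : b <= 2 by rewrite ler_pdivrMr ?mulr_gt0//; lra.
have mono x y : 0 <= x -> x <= y -> x `^ gamma <= y `^ gamma.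
  move=> x0 xy; apply: ge0_ler_powR; rewrite ?nnegrE//; first exact: ltW.
  exact: le_trans xy.
pose G (i : 'I_m) := (column_tail E c ord0 `&` column_tail E c (lift ord0 i))
  `&` data_event E ord0.
have mtail k : measurable (column_tail E c k) by exact: measurable_column_tail.
rewrite -[m in q *+ m](size_enum_ord m).
apply: (expectation_sqr_ge (G := G)) => //.
- by apply: measurable_funB => //; exact: measurable_plugin_estimator.
- exact: powR_ge0.
- move=> i; apply: measurableI; first exact: measurableI.
  exact: measurable_data_event.
- move=> i; rewrite probability_setI_data_event ?qP//.
  exact: measurableI.
move=> t; rewrite big_enum/=.
(* Every [G i] lies in both events; if one fails, all indicators vanish and the bound is trivial. *)
have [[tail0 Dt]|tD] := pselect (column_tail E c ord0 t /\ data_event E ord0 t); last first.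
  rewrite big1 ?mulr0// => i _; rewrite indicE memNset//= => -[[]] *.
  by apply: tD.
have bE k : column_tail E c k t ->
    b <= 2 / (alpha * n%:R) * \sum_(i < n) noise E i k t.
  move=> tailk; apply: (le_trans _ (ler_wpM2l _ tailk)); last first.
    by rewrite divr_ge0 ?mulr_ge0// ltW.
  rewrite le_eqVlt; apply/orP; left; apply/eqP.
  have : n%:R = Num.sqrt n%:R ^+ 2 :> R by rewrite sqr_sqrtr// ltW.
  rewrite /b; move: (Num.sqrt _) s0 => s s0 ->.
  by field; rewrite !gt_eqF.
apply: le_trans (ler_norm _).
rewrite /plugin_estimator power_sum_vertex// big_ord_recl/= lerBrDl.
apply: lerD.
  (* Coordinate 0 is estimated by 1 plus nonnegative noise, so it alone offsets $F_\gamma=1$. *)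
  have {1}-> : 1 = 1 `^ gamma :> R by rewrite powR1.
  apply: mono => //.
  apply: clip02_ge; first by rewrite ler1n.
  by rewrite privatized_meanE// eqxx lerDl (le_trans b0)// bE.
rewrite mulr_sumr; apply: ler_sum => i _.
rewrite indicE; case: (boolP (t \in G i)) => [|_]; last by rewrite mulr0 powR_ge0.
rewrite inE => -[[_ taili] _]; rewrite mulr1; apply: mono => //.
by apply: clip02_ge => //; rewrite privatized_meanE//= add0r bE.
Qed.

End degenerate_law.

(** * Assembly of the constants *)

Theorem proposition2p2 (R : realType) (gamma : R) (gamma_gt0 : 0 < gamma)
    (gamma_neq1 : gamma != 1) :
  exists c : R, 0 < c /\
    forall (K : nat) (alpha : R), (2 <= K)%N -> 0 < alpha < 1 ->
    exists N : nat, forall n : nat,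
      (N <= n)%N -> (0 < n)%N -> 1 <= alpha ^+ 2 * n%:R ->
      forall E : forall p : prob_simplex R K, experiment n (\val p),
        ((c * (K%:R ^+ 2 / (alpha ^+ 2 * n%:R) `^ gamma))%:E
           <= maximal_risk E gamma alpha)%E.
Proof.
have ln_gt0 : 0 < ln (33/32) :> R by rewrite ln_gt0//; lra.
(* This gives $4\ln(33/32)\le 1\le\alpha\sqrt n$, as the vertex bound requires. *)
have ln_le : ln (33/32) <= 32^-1 :> R.
  by have := @le_ln1Dx R 32^-1; rewrite (_ : 1 + 32^-1 = 33/32); [apply|]; lra.
have q0 : 0 < 1536^-1 * 1536^-1 :> R by apply: mulr_gt0; rewrite invr_gt0 ltr0n.
have tails := @column_tails_ge R.
move: (1536^-1 * 1536^-1) q0 tails => q q0.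
have [c0 c1] : 0 < 4 * ln (33/32) :> R /\ 4 * ln (33/32) <= 1 :> R by split; lra.
move: (4 * ln (33/32)) c0 c1 => c c0 c1 tails.
(* The square of $(2c)^\gamma q$, divided by 4 because $(K-1)^2\ge K^2/4$ for $K\ge 2$. *)
exists (((2 * c) ^+ 2) `^ gamma * q ^+ 2 / 4); split.
  apply: divr_gt0 => //; apply: mulr_gt0; last exact: exprn_gt0.
  by apply: powR_gt0; apply: exprn_gt0; exact: mulr_gt0.
(* The threshold is 0: the bound holds as soon as $\alpha^2 n\ge 1$. *)
move=> [//|m] alpha m1 /andP[a0 a1]; exists 0%N => n _ n0 an E.
pose p0 : prob_simplex R m.+1 := SigSub (mem_set (vertex_simplex R m)).
have n0' : 0 < n%:R :> R by rewrite ltr0n.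
have s0 : 0 < Num.sqrt n%:R :> R by rewrite sqrtr_gt0.
have sn : (alpha * Num.sqrt n%:R) ^+ 2 = alpha ^+ 2 * n%:R.
  by rewrite exprMn sqr_sqrtr// ltW.
have an1 : 1 <= alpha * Num.sqrt n%:R.
  by have := an; rewrite -sn expr_ge1// ltW// mulr_gt0.
have risk : (quadratic_risk (E p0) gamma alpha <= maximal_risk E gamma alpha)%E.
  by apply: ereal_sup_ubound; exists p0.
apply: le_trans risk.
have cols k : k != ord0 -> (q%:E <=
    law (E p0) (column_tail (E p0) c ord0 `&` column_tail (E p0) c k))%E.
  by move=> k0; apply: tails => //; rewrite eq_sym.
apply: le_trans (quadratic_risk_vertex_ge gamma_gt0 a0 n0
  (ltW c0) (le_trans c1 an1) (ltW q0) cols).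
rewrite lee_fin -sn.
have y0 : 0 < alpha * Num.sqrt n%:R by exact: mulr_gt0.
move: (alpha * Num.sqrt n%:R) y0 => y y0; have x0 : 0 <= 2 * c by rewrite mulr_ge0// ltW.
move: (2 * c) x0 => x x0.
rewrite [X in _ <= X]exprMn.
have -> : ((x / y) `^ gamma) ^+ 2 = (x ^+ 2) `^ gamma / (y ^+ 2) `^ gamma.
  have xy : 0 <= x / y by rewrite divr_ge0// ltW.
  rewrite [LHS]expr2 -(powRM _ xy xy) -expr2 expr_div_n powRM ?invr_ge0 ?sqr_ge0//.
  by rewrite -(powR_inv1 (sqr_ge0 y)) -powRrM mulN1r powRN.
have m2 : m.+1%:R ^+ 2 / 4 <= m%:R ^+ 2 :> R.
  have : 1 <= m%:R :> R by rewrite ler1n.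
  by rewrite -natr1; nra.
rewrite -[q *+ m]mulr_natr [X in _ <= _ * X]exprMn.
have z0 : 0 <= (x ^+ 2) `^ gamma / (y ^+ 2) `^ gamma * q ^+ 2.
  by rewrite mulr_ge0 ?sqr_ge0// divr_ge0 ?powR_ge0.
apply: le_trans (_ : _ <= _ * (m.+1%:R ^+ 2 / 4)) _; last first.
  by rewrite [X in _ <= X]mulrA; exact: ler_wpM2l.
by rewrite le_eqVlt; apply/orP; left; apply/eqP; ring.
Qed.
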